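(* Let $L:TQ\to\mathbb{R}$ be a Lagrangian, let $r\ge 1$, and let $\{(b_i,c_i)\}_{i=1}^m$ be a symmetric quadrature rule. Then the symmetric Taylor variational integrator, i.e. the map $\tilde F_{L_d}^{h}:(q_0,p_0)\mapsto(q_1,p_1)$ implicitly defined by $$p_0=-D_1L_d(q_0,q_1;h),\qquad p_1=D_2L_d(q_0,q_1;h),$$ where $L_d$ is the symmetric Taylor discrete Lagrangian built from the Taylor methods for $L$ and the given quadrature rule, is a symmetric method: it is equal to its adjoint, $\tilde F_{L_d}^{h}=(\tilde F_{L_d}^{-h})^{-1}$.
   Context: Work in coordinates on $Q$ (open subset of $\mathbb{R}^n$). The Euler--Lagrange equation of $L$ is assumed to be of the form $\ddot q=f(q,\dot q,t)$, with $f$ smooth enough for the Taylor methods to be defined. $\pi_Q:(q,v)\mapsto q$ is the canonical projection, and $\pi_V:(q,v)\mapsto v$ denotes the velocity component. Taylor method: for an integer $\rho\ge0$ and $t\in\mathbb{R}$ (of either sign), $$\Psi^{(\rho)}_t(q,v)=\Big(\sum_{k=0}^{\rho}\tfrac{t^k}{k!}q^{(k)},\ \sum_{k=1}^{\rho+1}\tfrac{t^{k-1}}{(k-1)!}q^{(k)}\Big),$$ where $q^{(k)}$ are the time derivatives at time $0$ of the Euler--Lagrange solution with initial data $(q,v)$, computed from $f$ and its successive total time derivatives. Symmetric quadrature rule: $c_i=1-c_{m-i+1}$ and $b_i=b_{m-i+1}$ for all $i$, with $c_i\in[0,1]$. Symmetric Taylor discrete Lagrangian. Given $(q_0,q_1,h)$: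 (i) solve for $\tilde v_0,\tilde v_1$ in $q_1=\pi_Q\circ\Psi^{(r)}_h(q_0,\tilde v_0)$ and $q_0=\pi_Q\circ\Psi^{(r)}_{-h}(q_1,\tilde v_1)$ (for small $|h|$, with the (locally unique) solutions understood); (ii) set $$q_{c_i}=c_i\,\pi_Q\circ\Psi^{(r)}_{c_ih}(q_0,\tilde v_0)+(1-c_i)\,\pi_Q\circ\Psi^{(r)}_{-(1-c_i)h}(q_1,\tilde v_1),$$ $$v_{c_i}=c_i\,\pi_V\circ\Psi^{(r-1)}_{c_ih}(q_0,\tilde v_0)+(1-c_i)\,\pi_V\circ\Psi^{(r-1)}_{-(1-c_i)h}(q_1,\tilde v_1),$$ except that at a node $c_i=0$ one uses $(q_0,\tilde v_0)$ and at a node $c_i=1$ one uses $(q_1,\tilde v_1)$; (iii) set $L_d(q_0,q_1;h)=h\sum_{i=1}^m b_iL(q_{c_i},v_{c_i})$. The same formulas define $L_d$ for negative $h$. The implicit equations are assumed to define the map $\tilde F_{L_d}^{h}$ locally for small $|h|\neq0$. *)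

(* Defs.v *)
From HB Require Import structures.
From mathcomp Require Import all_boot all_order all_algebra.
From mathcomp Require Import all_classical all_reals all_analysis.

Set Implicit Arguments.
Unset Strict Implicit.
Unset Printing Implicit Defensive.

Import Order.TTheory GRing.Theory Num.Theory.
Import numFieldNormedType.Exports.

Local Open Scope classical_set_scope.
Local Open Scope ring_scope.

Definition grad (R : realType) (n : nat) (g : 'rV[R]_n -> R) (x : 'rV[R]_n) :
    'rV[R]_n :=
  \row_j 'D_(delta_mx 0 j) g x.

(* TQ = Q * R^n for Q open in R^n. Functions on TQ are total functions of which
   only the values on TQ matter. *)
Definition TQ (R : realType) (n : nat) (Q : set 'rV[R]_n) :
    set ('rV[R]_n * 'rV[R]_n) :=
  [set z | Q z.1].

Definition dLdq (R : realType) (n : nat) (L : 'rV[R]_n * 'rV[R]_n -> R)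
    (z : 'rV[R]_n * 'rV[R]_n) : 'rV[R]_n :=
  grad (fun q => L (q, z.2)) z.1.

Definition dLdv (R : realType) (n : nat) (L : 'rV[R]_n * 'rV[R]_n -> R)
    (z : 'rV[R]_n * 'rV[R]_n) : 'rV[R]_n :=
  grad (fun v => L (z.1, v)) z.2.

Definition smooth_lagrangian (R : realType) (n : nat) (Q : set 'rV[R]_n)
    (L : 'rV[R]_n * 'rV[R]_n -> R) : Prop :=
  forall z, TQ Q z ->
    [/\ differentiable L z, differentiable (dLdq L) z
      & differentiable (dLdv L) z].

Definition EL_form (R : realType) (n : nat) (Q : set 'rV[R]_n)
    (L : 'rV[R]_n * 'rV[R]_n -> R)
    (f : 'rV[R]_n * 'rV[R]_n * R -> 'rV[R]_n) : Prop :=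
  forall (a b : R) (g : R -> 'rV[R]_n),
    (forall t, a < t < b ->
      [/\ Q (g t), derivable g t 1 & derivable (derive1 g) t 1]) ->
    ((forall t, a < t < b ->
        derive1 (fun s => dLdv L (g s, derive1 g s)) t
        = dLdq L (g t, derive1 g t)) <->
     (forall t, a < t < b -> derive1 (derive1 g) t = f (g t, derive1 g t, t))).

(* jet f k (q, v, t) is the k-th time derivative of the solution of
   q'' = f(q, q', t) that has position q and velocity v at time t. Each step is
   the total time derivative d/dt = v . D_q + f . D_v + D_t, so that
   jet f 1 (q, v, t) = v and jet f 2 = f. *)
Fixpoint jet (R : realType) (n : nat)
    (f : 'rV[R]_n * 'rV[R]_n * R -> 'rV[R]_n) (k : nat)
    : 'rV[R]_n * 'rV[R]_n * R -> 'rV[R]_n :=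
  match k with
  | 0 => fun x => x.1.1
  | k'.+1 => fun x => 'D_((x.1.2, f x, 1)) (jet f k') x
  end.

(* Differentiability of jet f k for k <= r is what makes the derivatives up to
   order r + 1 used by the Taylor method of order r meaningful. *)
Definition taylor_smooth (R : realType) (n : nat) (Q : set 'rV[R]_n)
    (f : 'rV[R]_n * 'rV[R]_n * R -> 'rV[R]_n) (r : nat) : Prop :=
  forall k : nat, (k <= r)%N ->
  forall x, TQ Q x.1 -> differentiable (jet f k) x.

Definition taylor (R : realType) (n : nat)
    (f : 'rV[R]_n * 'rV[R]_n * R -> 'rV[R]_n) (rho : nat) (t : R)
    (z : 'rV[R]_n * 'rV[R]_n) : 'rV[R]_n * 'rV[R]_n :=
  (\sum_(0 <= k < rho.+1) (t ^+ k / k`!%:R) *: jet f k (z, 0),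
   \sum_(1 <= k < rho.+2) (t ^+ k.-1 / (k.-1)`!%:R) *: jet f k (z, 0)).

Definition symmetric_rule (R : realType) (m : nat) (b c : 'I_m -> R) : Prop :=
  forall i, [/\ 0 <= c i <= 1, c i = 1 - c (rev_ord i) & b i = b (rev_ord i)].

(* W is the open subset of TQ in which the implicit equations for the boundary
   velocities are solved: it selects the local solution branch. *)
Definition locally_unique (R : realType) (n : nat)
    (f : 'rV[R]_n * 'rV[R]_n * R -> 'rV[R]_n) (r : nat)
    (W : set ('rV[R]_n * 'rV[R]_n)) (h : R) : Prop :=
  forall q v v', W (q, v) -> W (q, v') ->
    (taylor f r h (q, v)).1 = (taylor f r h (q, v')).1 -> v = v'.

Definition solves0 (R : realType) (n : nat)
    (f : 'rV[R]_n * 'rV[R]_n * R -> 'rV[R]_n) (r : nat)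
    (W : set ('rV[R]_n * 'rV[R]_n)) (h : R) (q0 q1 : 'rV[R]_n) :
    set 'rV[R]_n :=
  [set v0 | W (q0, v0) /\ q1 = (taylor f r h (q0, v0)).1].

Definition solves1 (R : realType) (n : nat)
    (f : 'rV[R]_n * 'rV[R]_n * R -> 'rV[R]_n) (r : nat)
    (W : set ('rV[R]_n * 'rV[R]_n)) (h : R) (q0 q1 : 'rV[R]_n) :
    set 'rV[R]_n :=
  [set v1 | W (q1, v1) /\ q0 = (taylor f r (- h) (q1, v1)).1].

Definition vt0 (R : realType) (n : nat)
    (f : 'rV[R]_n * 'rV[R]_n * R -> 'rV[R]_n) (r : nat)
    (W : set ('rV[R]_n * 'rV[R]_n)) (h : R) (q0 q1 : 'rV[R]_n) : 'rV[R]_n :=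
  xget 0 (solves0 f r W h q0 q1).

Definition vt1 (R : realType) (n : nat)
    (f : 'rV[R]_n * 'rV[R]_n * R -> 'rV[R]_n) (r : nat)
    (W : set ('rV[R]_n * 'rV[R]_n)) (h : R) (q0 q1 : 'rV[R]_n) : 'rV[R]_n :=
  xget 0 (solves1 f r W h q0 q1).

Definition node (R : realType) (n : nat)
    (f : 'rV[R]_n * 'rV[R]_n * R -> 'rV[R]_n) (r : nat)
    (W : set ('rV[R]_n * 'rV[R]_n)) (h : R) (q0 q1 : 'rV[R]_n) (c : R) :
    'rV[R]_n * 'rV[R]_n :=
  let z0 := (q0, vt0 f r W h q0 q1) in
  let z1 := (q1, vt1 f r W h q0 q1) in
  if c == 0 then z0 else if c == 1 then z1 else
  (c *: (taylor f r (c * h) z0).1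
     + (1 - c) *: (taylor f r (- ((1 - c) * h)) z1).1,
   c *: (taylor f r.-1 (c * h) z0).2
     + (1 - c) *: (taylor f r.-1 (- ((1 - c) * h)) z1).2).

Definition Ld (R : realType) (n m : nat) (L : 'rV[R]_n * 'rV[R]_n -> R)
    (f : 'rV[R]_n * 'rV[R]_n * R -> 'rV[R]_n) (r : nat) (b c : 'I_m -> R)
    (W : set ('rV[R]_n * 'rV[R]_n)) (h : R) (q0 q1 : 'rV[R]_n) : R :=
  h * \sum_(i < m) b i * L (node f r W h q0 q1 (c i)).

(* The pairs (q0, q1) at which Ld is defined: both boundary velocities exist
   and L is evaluated at points of TQ only. *)
Definition Ld_dom (R : realType) (n m : nat) (Q : set 'rV[R]_n)
    (f : 'rV[R]_n * 'rV[R]_n * R -> 'rV[R]_n) (r : nat) (c : 'I_m -> R)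
    (W : set ('rV[R]_n * 'rV[R]_n)) (h : R) : set ('rV[R]_n * 'rV[R]_n) :=
  [set x | [/\ solves0 f r W h x.1 x.2 !=set0,
               solves1 f r W h x.1 x.2 !=set0
             & forall i, TQ Q (node f r W h x.1 x.2 (c i))]].

(* p0 = - D_1 Ld(q0, q1; h) and p1 = D_2 Ld(q0, q1; h). Stating these equations
   presupposes that Ld is defined around (q0, q1) and differentiable there. *)
Definition discrete_EL (R : realType) (n m : nat) (Q : set 'rV[R]_n)
    (L : 'rV[R]_n * 'rV[R]_n -> R)
    (f : 'rV[R]_n * 'rV[R]_n * R -> 'rV[R]_n) (r : nat) (b c : 'I_m -> R)
    (W : set ('rV[R]_n * 'rV[R]_n)) (h : R)
    (z0 z1 : 'rV[R]_n * 'rV[R]_n) : Prop :=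
  let: (q0, p0) := z0 in let: (q1, p1) := z1 in
  [/\ (Ld_dom Q f r c W h)^° (q0, q1),
      differentiable
        (fun x : 'rV[R]_n * 'rV[R]_n => Ld L f r b c W h x.1 x.2) (q0, q1),
      p0 = - grad (fun q => Ld L f r b c W h q q1) q0
    & p1 = grad (fun q => Ld L f r b c W h q0 q) q1].

Definition defines_map (R : realType) (n m : nat) (Q : set 'rV[R]_n)
    (L : 'rV[R]_n * 'rV[R]_n -> R)
    (f : 'rV[R]_n * 'rV[R]_n * R -> 'rV[R]_n) (r : nat) (b c : 'I_m -> R)
    (W : set ('rV[R]_n * 'rV[R]_n)) (h : R) : Prop :=
  forall z0 z1 z1', discrete_EL Q L f r b c W h z0 z1 ->
    discrete_EL Q L f r b c W h z0 z1' -> z1 = z1'.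

Definition integrator_dom (R : realType) (n m : nat) (Q : set 'rV[R]_n)
    (L : 'rV[R]_n * 'rV[R]_n -> R)
    (f : 'rV[R]_n * 'rV[R]_n * R -> 'rV[R]_n) (r : nat) (b c : 'I_m -> R)
    (W : set ('rV[R]_n * 'rV[R]_n)) (h : R) : set ('rV[R]_n * 'rV[R]_n) :=
  [set z0 | exists z1, discrete_EL Q L f r b c W h z0 z1].

(* Only meaningful on integrator_dom. *)
Definition integrator (R : realType) (n m : nat) (Q : set 'rV[R]_n)
    (L : 'rV[R]_n * 'rV[R]_n -> R)
    (f : 'rV[R]_n * 'rV[R]_n * R -> 'rV[R]_n) (r : nat) (b c : 'I_m -> R)
    (W : set ('rV[R]_n * 'rV[R]_n)) (h : R) (z0 : 'rV[R]_n * 'rV[R]_n) :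
    'rV[R]_n * 'rV[R]_n :=
  xget (0, 0) [set z1 | discrete_EL Q L f r b c W h z0 z1].

(* f = g^-1 for the partial maps f with domain A and g with domain B. *)
Definition is_inverse_of (T U : choiceType) (A : set T) (f : T -> U)
    (B : set U) (g : U -> T) : Prop :=
  [/\ set_bij B A g, {in B, cancel g f} & {in A, cancel f g}].

(* Main.v *)
Require Import Defs.
From HB Require Import structures.
From mathcomp Require Import all_boot all_order all_algebra.
From mathcomp Require Import all_classical all_reals all_analysis.
Import Order.TTheory GRing.Theory Num.Theory.
Import numFieldNormedType.Exports.
Local Open Scope classical_set_scope.
Local Open Scope ring_scope.

(** The construction is invariant under exchanging the two endpoints while
    reversing the sign of the step. Solving for the velocity at [q0] with step
    [h] is literally the same equation as solving for the velocity at the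
    second endpoint with the pair [(q1, q0)] and step [- h], so the two
    boundary velocities are exchanged ([vt0_opp], [vt1_opp]). The interpolated
    state at the node [c] is a combination of a forward Taylor step of length
    [c h] with weight [c] and a backward one of length [(1 - c) h] with weight
    [1 - c]; hence it becomes the state at the node [1 - c] ([node_opp]). A
    symmetric rule has equal weights at [c] and [1 - c], and only the factor
    [h] in front of the quadrature sum changes sign:
      [Ld (- h) q1 q0 = - Ld h q0 q1]   ([Ld_opp]).
    Differentiating this identity in either slot turns the equations
    [p0 = - D_1 Ld], [p1 = D_2 Ld] for the step [h] into the same equations for
    the step [- h] with [(q0, p0)] and [(q1, p1)] exchanged
    ([discrete_EL_opp]). The relations defining the two integrators are
    therefore converse to each other, and both are functional by hypothesis,
    so the partial maps that they define are mutually inverse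
    ([is_inverse_of_converse]). *)

(** On the domain of a functional relation the chosen value is the only related
    one, so no default value of [xget] is ever met, and the domain of the
    converse relation is exactly the range of the chosen map. *)
Lemma is_inverse_of_converse (T : choiceType) (x0 : T) (E E' : T -> T -> Prop) :
  (forall x y, E x y <-> E' y x) ->
  (forall x y y', E x y -> E x y' -> y = y') ->
  (forall x y y', E' x y -> E' x y' -> y = y') ->
  is_inverse_of [set x | exists y, E x y] (fun x => xget x0 [set y | E x y])
                [set x | exists y, E' x y] (fun x => xget x0 [set y | E' x y]).
Proof.
move=> EE' funE funE'.
have valE x y : E x y -> xget x0 [set z | E x z] = y.
  by move=> Exy; apply: xget_unique => // z Exz; exact: funE Exz Exy.
have valE' x y : E' x y -> xget x0 [set z | E' x z] = y.
  by move=> Exy; apply: xget_unique => // z Exz; exact: funE' Exz Exy.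
split; first split.
- by move=> x [y E'xy]; exists x; rewrite (valE' _ _ E'xy); apply/EE'.
- move=> x x' /set_mem[y E'xy] /set_mem[y' E'xy'].
  rewrite (valE' _ _ E'xy) (valE' _ _ E'xy') => eqy.
  by apply: (funE y); apply/EE'; rewrite // eqy.
- move=> y [x Eyx]; have E'xy : E' x y by apply/EE'.
  by exists x; [exists y | exact: valE'].
- move=> x /set_mem[y E'xy].
  by rewrite (valE' _ _ E'xy); apply: valE; apply/EE'.
- move=> y /set_mem[x Eyx].
  by rewrite (valE _ _ Eyx); apply: valE'; apply/EE'.
Qed.

(** Without differentiability the directional derivatives are unspecified
    limits, which need not change sign with the function. *)
Lemma gradN (R : realType) (n : nat) (g : 'rV[R]_n -> R) (x : 'rV[R]_n) :
  differentiable g x -> grad (fun y => - g y) x = - grad g x.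
Proof.
move=> dg; apply/rowP => j; rewrite !mxE.
by have := @deriveN _ _ _ g x (delta_mx 0 j) (diff_derivable dg).
Qed.

Lemma differentiable_swap (R : realType) (U V : normedModType R) (x : U * V) :
  differentiable (fun y : U * V => (y.2, y.1)) x.
Proof.
have dsnd : differentiable (snd : U * V -> V) x.
  by apply: linear_differentiable => y; exact: cvg_snd.
have dfst : differentiable (fst : U * V -> U) x.
  by apply: linear_differentiable => y; exact: cvg_fst.
exact: differentiable_pair dsnd dfst.
Qed.

Lemma differentiable_partial1 (R : realType) (U V W : normedModType R)
    (F : U * V -> W) (u : U) (v : V) :
  differentiable F (u, v) -> differentiable (fun u' => F (u', v)) u.
Proof.
by move=> dF; apply: (@differentiable_comp _ _ _ _ (fun u' => (u', v)) F);
  first exact: differentiable_pair.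
Qed.

Lemma differentiable_partial2 (R : realType) (U V W : normedModType R)
    (F : U * V -> W) (u : U) (v : V) :
  differentiable F (u, v) -> differentiable (fun v' => F (u, v')) v.
Proof.
by move=> dF; apply: (@differentiable_comp _ _ _ _ (fun v' => (u, v')) F);
  first exact: differentiable_pair.
Qed.

Section Reversal.
Context {R : realType} {n m : nat}.
Implicit Types (Q : set 'rV[R]_n) (L : 'rV[R]_n * 'rV[R]_n -> R).
Implicit Types (f : 'rV[R]_n * 'rV[R]_n * R -> 'rV[R]_n) (r : nat).
Implicit Types (b c : 'I_m -> R) (W : set ('rV[R]_n * 'rV[R]_n)).
Implicit Types (h : R) (q : 'rV[R]_n) (z : 'rV[R]_n * 'rV[R]_n).

Lemma solves0_opp f r W h q0 q1 :
  solves0 f r W (- h) q1 q0 = solves1 f r W h q0 q1.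
Proof. by []. Qed.

Lemma solves1_opp f r W h q0 q1 :
  solves1 f r W (- h) q1 q0 = solves0 f r W h q0 q1.
Proof. by rewrite /solves1 opprK. Qed.

Lemma vt0_opp f r W h q0 q1 : vt0 f r W (- h) q1 q0 = vt1 f r W h q0 q1.
Proof. by []. Qed.

Lemma vt1_opp f r W h q0 q1 : vt1 f r W (- h) q1 q0 = vt0 f r W h q0 q1.
Proof. by rewrite /vt1 solves1_opp. Qed.

(** The two Taylor steps and their weights trade places. The end nodes are
    consistent with this: [c = 0] and [1 - c = 1] select the same endpoint. *)
Lemma node_opp f r W h q0 q1 (c : R) :
  node f r W (- h) q1 q0 (1 - c) = node f r W h q0 q1 c.
Proof.
have eq0 : (1 - c == 0) = (c == 1) by rewrite subr_eq0 eq_sym.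
have eq1 : (1 - c == 1) = (c == 0) by rewrite -subr_eq0 addrAC subrr sub0r oppr_eq0.
rewrite /node vt0_opp vt1_opp eq0 eq1.
have [->|_] := eqVneq c 1; first by rewrite oner_eq0.
by case: eqVneq => // _; rewrite subKr !mulrN opprK ![_ *: _ + c *: _]addrC.
Qed.

(** Reindexing the quadrature sum by [rev_ord] pairs the node [c] of one side
    with the node [1 - c] of the other; only the prefactor [h] is odd. *)
Lemma Ld_opp L f r b c W h q0 q1 : symmetric_rule b c ->
  Ld L f r b c W (- h) q1 q0 = - Ld L f r b c W h q0 q1.
Proof.
move=> sym; rewrite /Ld mulNr (reindex_inj rev_ord_inj) /=.
congr (- (_ * _)); apply: eq_bigr => i _.
have [_ _ <-] := sym i; have [_ -> _] := sym (rev_ord i).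
by rewrite rev_ordK node_opp.
Qed.

Lemma Ld_dom_opp Q f r b c W h q0 q1 : symmetric_rule b c ->
  Ld_dom Q f r c W h (q0, q1) -> Ld_dom Q f r c W (- h) (q1, q0).
Proof.
move=> sym [/= s0 s1 nd]; split => /=; rewrite ?solves0_opp ?solves1_opp //.
by move=> i; have [_ -> _] := sym i; rewrite node_opp.
Qed.

(** Both sign changes come from [Ld_opp]: [p1 = D_2 Ld] has no minus sign, but
    the reversed [Ld] is the negative of the original one, so the same value is
    [- D_1] of the reversed one; likewise for [p0]. Being interior to the domain
    and joint differentiability pass through the exchange of the two points,
    which is continuous and linear. *)
Lemma discrete_EL_opp_impl Q L f r b c W h z0 z1 : symmetric_rule b c ->
  discrete_EL Q L f r b c W h z0 z1 -> discrete_EL Q L f r b c W (- h) z1 z0.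
Proof.
case: z0 => q0 p0; case: z1 => q1 p1 sym [dom dL -> ->].
have LdN q q' : Ld L f r b c W (- h) q q' = - Ld L f r b c W h q' q.
  exact: Ld_opp.
split.
- have cont : {for (q1, q0),
      continuous (fun x : 'rV[R]_n * 'rV[R]_n => (x.2, x.1))}.
    exact/differentiable_continuous/differentiable_swap.
  have swapped : \forall x \near (q1, q0),
      Ld_dom Q f r c W h ((x.2, x.1) : 'rV[R]_n * 'rV[R]_n).
    exact: cont _ dom.
  apply: filterS swapped => -[q q'] /=.
  by apply: Ld_dom_opp.
- have -> : (fun x : 'rV[R]_n * 'rV[R]_n => Ld L f r b c W (- h) x.1 x.2) =
      - ((fun x : 'rV[R]_n * 'rV[R]_n => Ld L f r b c W h x.1 x.2) \o
         (fun x => (x.2, x.1))).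
    by apply/funext => x /=; rewrite LdN.
  apply: differentiableN; apply: differentiable_comp => //.
  exact: differentiable_swap.
- have -> : (fun q => Ld L f r b c W (- h) q q0) =
      (fun q => - Ld L f r b c W h q0 q) by exact/funext.
  rewrite gradN ?opprK //.
  exact: (differentiable_partial2 _ _ _ _ _ _ _ dL).
- have -> : (fun q => Ld L f r b c W (- h) q1 q) =
      (fun q => - Ld L f r b c W h q q1) by exact/funext.
  rewrite gradN //.
  exact: (differentiable_partial1 _ _ _ _ _ _ _ dL).
Qed.

(** The reversal is an involution, so one implication gives both. *)
Lemma discrete_EL_opp Q L f r b c W h z0 z1 : symmetric_rule b c ->
  discrete_EL Q L f r b c W h z0 z1 <-> discrete_EL Q L f r b c W (- h) z1 z0.
Proof.
move=> sym; split; first exact: discrete_EL_opp_impl.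
by move=> /(discrete_EL_opp_impl _ _ _ _ _ _ _ _ _ _ sym); rewrite opprK.
Qed.

End Reversal.

Theorem theorem3 (R : realType) (n m r : nat)
  (Q : set 'rV[R]_n) (L : 'rV[R]_n * 'rV[R]_n -> R)
  (f : 'rV[R]_n * 'rV[R]_n * R -> 'rV[R]_n)
  (b c : 'I_m -> R)
  (W : set ('rV[R]_n * 'rV[R]_n)) (h0 : R) :
  open Q ->
  smooth_lagrangian Q L ->
  EL_form Q L f ->
  (1 <= r)%N ->
  taylor_smooth Q f r ->
  symmetric_rule b c ->
  open W -> W `<=` TQ Q ->
  0 < h0 ->
  (forall h : R, 0 < `|h| < h0 -> locally_unique f r W h) ->
  (forall h : R, 0 < `|h| < h0 -> defines_map Q L f r b c W h) ->
  forall h : R, 0 < `|h| < h0 ->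
    is_inverse_of (integrator_dom Q L f r b c W h)
                  (integrator Q L f r b c W h)
                  (integrator_dom Q L f r b c W (- h))
                  (integrator Q L f r b c W (- h)).
Proof.
move=> _ _ _ _ _ sym _ _ _ _ dmap h hh0.
apply: is_inverse_of_converse.
- by move=> z0 z1; exact: discrete_EL_opp.
- exact: dmap.
- by apply: dmap; rewrite normrN.
Qed.
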